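(* Let $T$ be a theory of continuous first order logic and $\varphi(x,y)$ a formula which is stable in $T$, and write $\tilde\varphi(y,x)=\varphi(x,y)$. Let $M\models T$, $p(x)\in \mathrm S_\varphi(M)$ and $q(y)\in \mathrm S_{\tilde\varphi}(M)$. Let $d_p\varphi(y)$ and $d_q\tilde\varphi(x)$ be their respective definitions (which are a $\tilde\varphi$-predicate and a $\varphi$-predicate over $M$, respectively). Then $$d_p\varphi(y)^q = d_q\tilde\varphi(x)^p .$$
   Context: **Continuous logic.** Truth values lie in $[0,1]$, $0$ meaning true. A (metric, possibly many-sorted) continuous signature $\mathcal L$ consists of function and predicate symbols of finite arities, a distinguished binary predicate symbol $d$ on each sort, and for each symbol and each argument a uniform continuity modulus. An $\mathcal L$-structure interprets function symbols by functions and predicate symbols by $[0,1]$-valued functions, with $d$ a complete metric and each symbol respecting its moduli in each argument. Formulae are built from atomic ones using the connectives $\neg x=1-x$, $x/2$, $x\dot- y=\max(x-y,0)$ and the quantifiers $\sup,\inf$. A condition is $\varphi=0$; a theory (not necessarily complete) is a set of conditions without free variables. Finite tuples of variables are treated as single variables. **Stability.** $\varphi(x,y)$ is $\varepsilon$-stable ($\varepsilon>0$) if in no model of $T$ is there an infinite sequence $(a_i,b_i)_{i<\omega}$ with $|\varphi(a_i,b_j)-\varphi(a_j,b_i)|\ge\varepsilon$ for all $i<j$; it is stable if $\varepsilon$-stable for all $\varepsilon>0$. ($\varphi$ is stable iff $\tilde\varphi$ is.) **Types.** $\mathrm S_x(M)$ is the space of complete types over $M$ in the variable $x$ (sets of conditions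 with parameters in $M$ satisfied by some element of an elementary extension of $M$), with the coarsest topology making $p\mapsto\psi^p$ continuous for every formula $\psi(x)$ with parameters in $M$, where $\psi^p$ is the value of $\psi$ at a realisation of $p$. $\mathrm S_\varphi(M)$ is the quotient space of $\mathrm S_x(M)$ identifying two types when they give the same value to $\varphi(x,b)$ for every $b\in M$; similarly $\mathrm S_{\tilde\varphi}(M)$ is a quotient of $\mathrm S_y(M)$. A $\varphi$-predicate over $M$ is a continuous function $\psi:\mathrm S_\varphi(M)\to[0,1]$, also viewed as an $M$-definable predicate in $x$; its value at $p\in\mathrm S_\varphi(M)$ is written $\psi^p$ or $\psi(x)^p$. An $M$-definable predicate $\psi(y)$ is a continuous function $\mathrm S_y(M)\to[0,1]$ (equivalently a uniform limit of formulae with parameters in $M$), evaluated at $b$ in an elementary extension of $M$ through $\mathrm{tp}(b/M)$. The definition $d_p\varphi(y)$ of $p\in\mathrm S_\varphi(M)$ is the unique $M$-definable predicate $\psi(y)$ with $\varphi(x,b)^p=\psi(b)$ for all $b\in M$; since $\varphi$ is stable it exists and is a $\tilde\varphi$-predicate over $M$. *)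

(* Defs.v *)
From HB Require Import structures.
From mathcomp Require Import all_boot all_order all_algebra.
From mathcomp Require Import ring lra.
From mathcomp Require Import all_classical all_reals topology.

Set Implicit Arguments.
Unset Strict Implicit.
Unset Printing Implicit Defensive.

Import Order.TTheory GRing.Theory Num.Theory.
Import numFieldTopology.Exports.

Local Open Scope classical_set_scope.
Local Open Scope ring_scope.

(* Contexts are sorted families of variables [V : S -> Type], where [V s] is
   the type of variables of sort [s].  [V ~> W] is used both for renamings and,
   when [W] is the carrier of a structure, for assignments. *)
Notation "V ~> W" := (forall s, V s -> W s)
  (at level 99, right associativity, only parsing) : type_scope.

Section Families.
Variable S : Type.
Implicit Types V W Z : S -> Type.

Definition fsum V W : S -> Type := fun s => (V s + W s)%type.

Definition fjoin V W Z (f : V ~> Z) (g : W ~> Z) : fsum V W ~> Z :=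
  fun s v => match v with inl a => f s a | inr b => g s b end.

Inductive fext V (s0 : S) : S -> Type :=
| fnew : fext V s0 s0
| flift s of V s : fext V s0 s.

Definition fcons V Z s0 (m : Z s0) (f : V ~> Z) : fext V s0 ~> Z :=
  fun s v => match v in fext _ _ s return (V ~> Z) -> Z s0 -> Z s with
             | fnew => fun _ m => m
             | flift s v => fun f _ => f s v
             end f m.

Lemma famext V Z (f g : V ~> Z) :
  (forall s v, f s v = g s v) -> f = g.
Proof.
by move=> h; exact: (functional_extensionality_dep (fun s =>
  functional_extensionality_dep (h s))).
Qed.

(* A finite tuple of variables is given by the list of its sorts; a tuple
   of elements of these sorts in [M] is an assignment [place Gamma ~> M]. *)
Inductive place (Gamma : seq S) : S -> Type :=
| Place (i : 'I_(size Gamma)) : place Gamma (tnth (in_tuple Gamma) i).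

Definition fempty : S -> Type := fun _ => Empty_set.

End Families.

Arguments fnew {S V s0}.
Arguments flift {S V s0} s _.
Arguments fempty {S}.

Record modulus (R : realType) := Modulus {
  modulus_fun :> R -> R;
  modulus_gt0 : forall e, 0 < e -> 0 < modulus_fun e
}.

(* The distance symbol of each sort is not listed among the [psym]; its two
   moduli are [dmodl] and [dmodr]. *)
Record signature (R : realType) := Signature {
  sorts : Type;
  fsym : Type;
  fdom : fsym -> seq sorts;
  fcod : fsym -> sorts;
  fmod : forall f, 'I_(size (fdom f)) -> modulus R;
  psym : Type;
  pdom : psym -> seq sorts;
  pmod : forall P, 'I_(size (pdom P)) -> modulus R;
  dmodl : sorts -> modulus R;
  dmodr : sorts -> modulus R
}.

Section Syntax.
Variables (R : realType) (L : signature R).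

Inductive term (V : sorts L -> Type) : sorts L -> Type :=
| Var s of V s : term V s
| App (f : fsym L) of (place (fdom f) ~> term V) : term V (fcod f).

Inductive formula (V : sorts L -> Type) : Type :=
| Pred (P : psym L) of (place (pdom P) ~> term V)
| Dist s of term V s & term V s
| Neg of formula V
| Half of formula V
| Monus of formula V & formula V
| Sup s of formula (fext V s)
| Inf s of formula (fext V s).

Fixpoint term_rename V W (r : V ~> W) s (t : term V s) : term W s :=
  match t with
  | Var s v => Var (r s v)
  | App f ts => App (fun s u => term_rename r (ts s u))
  end.

Fixpoint rename V W (r : V ~> W) (phi : formula V) : formula W :=
  match phi with
  | Pred P ts => Pred (fun s u => term_rename r (ts s u))
  | Dist s t u => Dist (term_rename r t) (term_rename r u)
  | Neg f => Neg (rename r f)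
  | Half f => Half (rename r f)
  | Monus f g => Monus (rename r f) (rename r g)
  | Sup s f => Sup (rename (fcons fnew (fun t v => flift t (r t v))) f)
  | Inf s f => Inf (rename (fcons fnew (fun t v => flift t (r t v))) f)
  end.

Definition transpose V W (phi : formula (fsum V W)) : formula (fsum W V) :=
  rename (fjoin (fun _ v => inr v) (fun _ w => inl w)) phi.

(* The sentence [sigma] stands for the condition [sigma = 0]. *)
Definition theory := set (formula fempty).

End Syntax.

Definition agree_off S (Gamma : seq S) (Z : S -> Type) (i : 'I_(size Gamma))
    (a b : place Gamma ~> Z) : Prop :=
  forall j, j != i -> a _ (Place j) = b _ (Place j).

Record structure (R : realType) (L : signature R) := Structure {
  carrier :> sorts L -> metricType R;
  carrier_le1 : forall s (z w : carrier s), mdist z w <= 1;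
  carrier_complete : forall s (F : set_system (carrier s)),
    ProperFilter F -> cauchy F -> exists l : carrier s, F --> l;
  fint : forall f, (place (fdom f) ~> carrier) -> carrier (fcod f);
  pint : forall P, (place (pdom P) ~> carrier) -> R;
  pint_itv : forall P (a : place (pdom P) ~> carrier), 0 <= pint a <= 1;
  fint_unif : forall f i (a b : place (fdom f) ~> carrier) (e : R),
    0 < e -> agree_off i a b ->
    mdist (a _ (Place i)) (b _ (Place i)) < fmod i e ->
    mdist (fint a) (fint b) <= e;
  pint_unif : forall P i (a b : place (pdom P) ~> carrier) (e : R),
    0 < e -> agree_off i a b ->
    mdist (a _ (Place i)) (b _ (Place i)) < pmod i e ->
    `|pint a - pint b| <= e;
  dist_unifl : forall s (z w u : carrier s) (e : R), 0 < e ->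
    mdist z w < dmodl s e -> `|mdist z u - mdist w u| <= e;
  dist_unifr : forall s (z w u : carrier s) (e : R), 0 < e ->
    mdist z w < dmodr s e -> `|mdist u z - mdist u w| <= e
}.

Section Semantics.
Variables (R : realType) (L : signature R).

Fixpoint teval (M : structure L) V (rho : V ~> M) s (t : term V s) : M s :=
  match t with
  | Var s v => rho s v
  | App f ts => fint (fun s u => teval rho (ts s u))
  end.

(* Suprema and infima are those of the lattice [0,1]: sorts may be empty, and
   the supremum and infimum over an empty sort are 0 and 1. *)
Fixpoint feval (M : structure L) V (phi : formula V) : (V ~> M) -> R :=
  match phi with
  | Pred P ts => fun rho => pint (fun s u => teval rho (ts s u))
  | Dist s t u => fun rho => mdist (teval rho t) (teval rho u)
  | Neg f => fun rho => 1 - feval f rho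
  | Half f => fun rho => feval f rho / 2
  | Monus f g => fun rho => Num.max (feval f rho - feval g rho) 0
  | Sup s f => fun rho =>
      sup (0 |` range (fun m : M s => feval f (fcons m rho)))
  | Inf s f => fun rho =>
      inf (1 |` range (fun m : M s => feval f (fcons m rho)))
  end.

Lemma teval_rename (M : structure L) V W (r : V ~> W) (rho : W ~> M) s
    (t : term V s) :
  teval rho (term_rename r t) = teval (fun s v => rho s (r s v)) t.
Proof.
elim: t => //= f ts IH; congr fint.
by apply: famext => u v; exact: IH.
Qed.

Lemma feval_rename (M : structure L) V (f : formula V) W (r : V ~> W)
    (rho : W ~> M) :
  feval (rename r f) rho = feval f (fun s v => rho s (r s v)).
Proof.
elim: f W r rho => {V} [V P ts|V s t u|V f IH|V f IH|V f IHf g IHg|V s f IH|V s f IH]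
    W r rho /=; rewrite ?teval_rename ?IH ?IHf ?IHg //.
- congr pint; apply: famext => u v.
  exact: teval_rename.
- congr (sup (_ |` _)); apply: eq_imagel => m _; rewrite IH; congr feval.
  by apply: famext => t [].
- congr (inf (_ |` _)); apply: eq_imagel => m _; rewrite IH; congr feval.
  by apply: famext => t [].
Qed.

Lemma feval01 (M : structure L) V (f : formula V) (rho : V ~> M) :
  0 <= feval f rho <= 1.
Proof.
elim: f rho => {V} [V P ts|V s t u|V f IH|V f IH|V f IHf g IHg|V s f IH|V s f IH]
    rho /=.
- exact: pint_itv.
- by rewrite carrier_le1 mdist_ge0.
- by have /andP[h0 h1] := IH rho; rewrite subr_ge0 h1 lerBlDr lerDl.
- have /andP[h0 h1] := IH rho; rewrite divr_ge0 //= ler_pdivrMr //.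
  by rewrite mul1r (le_trans h1) // ler1n.
- have /andP[f0 f1] := IHf rho; have /andP[g0 g1] := IHg rho.
  by rewrite le_max lexx orbT /= ge_max ler01 andbT lerBlDr ler_wpDr.
- have ub : ubound (0 |` range (fun m => feval f (fcons m rho))) 1.
    by move=> _ [->|[m _ <-]]; rewrite ?ler01//; have /andP[] := IH (fcons m rho).
  apply/andP; split; last by apply: ge_sup => //; exists 0; left.
  by apply: ub_le_sup; [exists 1|left].
- have lb : lbound (1 |` range (fun m => feval f (fcons m rho))) 0.
    by move=> _ [->|[m _ <-]]; rewrite ?ler01//; have /andP[] := IH (fcons m rho).
  apply/andP; split; first by apply: lb_le_inf => //; exists 1; left.
  by apply: ge_inf; [exists 0|left].
Qed.

(* The constant k/2^n; the unused formula [f] only provides a formula with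
   value 0, namely [Monus f f]. *)
Fixpoint dyadic (V : sorts L -> Type) (f : @formula R L V) (n k : nat) : @formula R L V :=
  match n with
  | 0%N => if (k == 0)%N then Monus f f else @Neg R L V (Monus f f)
  | n'.+1 => if (k <= 2 ^ n')%N then Half (dyadic f n' k)
             else Neg (Half (dyadic f n' (2 ^ n - k)))
  end.

Lemma feval_dyadic (M : structure L) V (f : formula V) (rho : V ~> M) n k :
  (k <= 2 ^ n)%N -> feval (dyadic f n k) rho = k%:R / (2 ^ n)%:R.
Proof.
elim: n k => [|n IH] k kn /=.
  case: k kn => [|[|//]] _ /=; rewrite subrr maxxx ?mul0r //.
  by rewrite subr0 divr1.
have h2 : (2 ^ n)%:R != 0 :> R by rewrite pnatr_eq0 expn_eq0.
case: leqP => hk /=.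
  by rewrite IH // expnS natrM invfM mulrA mulrAC.
rewrite IH; last by rewrite leq_subLR expnS mul2n -addnn leq_add2r ltnW.
rewrite natrB // expnS natrM; field.
by rewrite h2.
Qed.

Lemma dyadic_between (r r' : R) : 0 <= r -> r < r' -> r' <= 1 ->
  exists n k : nat, [/\ (k <= 2 ^ n)%N, r <= k%:R / (2 ^ n)%:R
                      & k%:R / (2 ^ n)%:R < r'].
Proof.
move=> r0 rr' r'1; have d0 : 0 < r' - r by rewrite subr_gt0.
set n := (Num.trunc (r' - r)^-1).+1.
have hn : (r' - r)^-1 < (2 ^ n)%:R.
  apply: lt_trans (truncnS_gt _) _; rewrite ltr_nat.
  exact: ltn_expl.
have p0 : 0 < (2 ^ n)%:R :> R by rewrite ltr0n expn_gt0.
have hn1 : 1 < (r' - r) * (2 ^ n)%:R by rewrite mulrC -ltr_pdivrMr // mul1r.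
set k := (Num.trunc (r * (2 ^ n)%:R)).+1.
have k1 : r * (2 ^ n)%:R < k%:R by exact: truncnS_gt.
have k2 : k%:R <= r * (2 ^ n)%:R + 1.
  by rewrite /k -natr1 lerD2r truncn_le // mulr_ge0 // ltW.
have k3 : k%:R < r' * (2 ^ n)%:R.
  by apply: (le_lt_trans k2); rewrite mulrBl in hn1; rewrite -ltrBrDl.
exists n, k; split.
- rewrite -(@ler_nat R); apply: (le_trans (ltW k3)).
  by rewrite ler_piMl // ltW.
- by rewrite ler_pdivlMr // ltW.
- by rewrite ltr_pdivrMr.
Qed.

Definition model (T : theory L) (M : structure L) : Prop :=
  forall sigma, T sigma -> @feval M _ sigma (fun _ v => match v with end) = 0.

(* [carrier M] used as a context gives one constant per element of [M]: a
   formula in the context [fsum V M] is a formula in the variables [V] with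
   parameters in [M]. *)
Record elem_ext (M : structure L) := ElemExt {
  ext_structure :> structure L;
  ext_emb : M ~> ext_structure;
  ext_elem : forall psi : formula (fun s => M s),
    feval psi ext_emb = @feval M _ psi (fun _ m => m)
}.

Definition self_ext (M : structure L) : elem_ext M :=
  @ElemExt M M (fun _ m => m) (fun _ => erefl).

Section Stability.
Variables (T : theory L) (x y : seq (sorts L)).
Variable phi : formula (fsum (place x) (place y)).

Definition eps_stable (e : R) : Prop :=
  ~ exists M : structure L, model T M /\
    exists (a : nat -> place x ~> M) (b : nat -> place y ~> M),
      forall i j : nat, (i < j)%N ->
        e <= `|feval phi (fjoin (a i) (b j)) - feval phi (fjoin (a j) (b i))|.

Definition stable : Prop := forall e, 0 < e -> eps_stable e.

End Stability.

End Semantics.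

Section Types.
Variables (R : realType) (L : signature R) (M : structure L).
Implicit Type x y : seq (sorts L).

Definition pformula x := formula (fsum (place x) (fun s => M s)).

Definition conditions_of x (N : elem_ext M) (a : place x ~> N) :
    set (pformula x) :=
  [set psi | feval psi (fjoin a (@ext_emb _ _ _ N)) = 0].

Definition types x : Type :=
  {p : set (pformula x) | exists (N : elem_ext M) (a : place x ~> N),
     p = conditions_of a}.

Definition tp x (N : elem_ext M) (a : place x ~> N) : types x :=
  exist _ (conditions_of a) (ex_intro _ N (ex_intro _ a erefl)).

Definition tpM x (a : place x ~> M) : types x := @tp x (self_ext M) a.

(* The value of [psi] at a realisation of [p]; see [type_valE]. *)
Definition type_val x (psi : pformula x) (p : types x) : R :=
  get [set r | exists (N : elem_ext M) (a : place x ~> N),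
    sval p = conditions_of a /\ r = feval psi (fjoin a (@ext_emb _ _ _ N))].

Lemma conditions_inj x (N N' : elem_ext M) (a : place x ~> N)
    (a' : place x ~> N') (psi : pformula x) :
  conditions_of a = conditions_of a' ->
  feval psi (fjoin a (@ext_emb _ _ _ N)) =
  feval psi (fjoin a' (@ext_emb _ _ _ N')).
Proof.
wlog: N N' a a' / feval psi (fjoin a' (@ext_emb _ _ _ N')) <=
                  feval psi (fjoin a (@ext_emb _ _ _ N)).
  move=> wl h; case: (leP (feval psi (fjoin a' (@ext_emb _ _ _ N')))
                          (feval psi (fjoin a (@ext_emb _ _ _ N)))) => [l|/ltW l].
    exact: wl.
  by apply/esym/wl.
rewrite le_eqVlt => /orP[/eqP-> //|lt] h.
have /andP[r0 _] := feval01 psi (fjoin a' (@ext_emb _ _ _ N')).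
have /andP[_ r1] := feval01 psi (fjoin a (@ext_emb _ _ _ N)).
have [n [k [kn l1 l2]]] := dyadic_between r0 lt r1.
have: conditions_of a' (Monus psi (dyadic psi n k)).
  by rewrite /conditions_of /= feval_dyadic //; apply/max_idPr; rewrite subr_le0.
rewrite -h /conditions_of /= feval_dyadic // => /max_idPr; rewrite subr_le0.
by rewrite leNgt l2.
Qed.

Lemma type_valE x (N : elem_ext M) (a : place x ~> N) (psi : pformula x) :
  type_val psi (tp a) = feval psi (fjoin a (@ext_emb _ _ _ N)).
Proof.
rewrite /type_val; set A := [set _ | _].
have : A (feval psi (fjoin a (@ext_emb _ _ _ N))) by exists N, a.
move=> Ar; have [N' [a' [h ->]]] := getPex (ex_intro A _ Ar).
by apply/esym; exact: conditions_inj.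
Qed.

HB.instance Definition _ x := gen_eqMixin (types x).
HB.instance Definition _ x := gen_choiceMixin (types x).
HB.instance Definition _ x := Topological.copy (types x)
  (sup_topology (fun psi : pformula x =>
     Topological.class (initial_topology (type_val psi)))).

Definition definable_predicate x (psi : types x -> R) : Prop :=
  continuous psi /\ forall p, 0 <= psi p <= 1.

Section Local.
Variables x y : seq (sorts L).
Variable phi : formula (fsum (place x) (place y)).

(* phi(x,b), the [y]-variables being replaced by the constants [b] *)
Definition inst_at (b : place y ~> M) : pformula x :=
  rename (fjoin (fun _ v => inl v) (fun s w => inr (b s w))) phi.

Definition same_phi (p p' : types x) : bool :=
  `[< forall b : place y ~> M,
        type_val (inst_at b) p = type_val (inst_at b) p' >].

Lemma same_phi_equiv : equiv_class_of same_phi.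
Proof.
split=> [p | p p' | p p' p''].
- exact/asboolP.
- by apply/asboolP/asboolP => h b; rewrite h.
- by move=> /asboolP h /asboolP h'; apply/asboolP => b; rewrite h.
Qed.

Canonical same_phi_equiv_rel := EquivRelPack same_phi_equiv.

Definition phi_types : Type :=
  quotient_topology {eq_quot same_phi_equiv_rel}%qT.

Definition phi_type_of (p : types x) : phi_types := (\pi_phi_types p)%qT.

(* the value phi(x,b)^p, for p in S_phi(M); see [phi_valE] *)
Definition phi_val (b : place y ~> M) (p : phi_types) : R :=
  type_val (inst_at b) (repr p).

Lemma phi_valE (b : place y ~> M) (p : types x) :
  phi_val b (phi_type_of p) = type_val (inst_at b) p.
Proof.
rewrite /phi_val.
have : repr (phi_type_of p) = p %[mod phi_types]%qT by rewrite reprK.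
move=> /eqquotP/asboolP; exact.
Qed.

Definition phi_predicate (psi : phi_types -> R) : Prop :=
  continuous psi /\ forall p, 0 <= psi p <= 1.

(* A phi-predicate viewed as an M-definable predicate in [x] *)
Definition as_definable (psi : phi_types -> R) : types x -> R :=
  psi \o phi_type_of.

Definition is_definition (p : phi_types) (psi : types y -> R) : Prop :=
  definable_predicate psi /\
  forall b : place y ~> M, phi_val b p = psi (tpM b).

End Local.
End Types.

(* Main.v *)
Require Import Defs.
From mathcomp Require Import all_boot all_order all_algebra.
From mathcomp Require Import lra.
From mathcomp Require Import all_classical all_reals topology.

Import Order.TTheory GRing.Theory Num.Theory.
Import numFieldTopology.Exports.

Local Open Scope classical_set_scope.
Local Open Scope ring_scope.

(** The statement is Grothendieck's double limit theorem.  For tuples [a], [b]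
of [M], write [phi(a, q)] for the value of [phi(a, y)] at [q].  The heart of
the matter is that [phi(a, q)] tends to [dp q] as the type of [a] tends to [p]
([double_limit]).  If it did not, there would be pairs [(a_i, b_i)] of tuples
of [M], chosen in turn, with [a_i] so close to [p] that [phi(a_i, b_j)] is
nearly [dp b_j], itself nearly [dp q], for [j < i], with [b_i] so close to [q]
that [phi(a_j, b_i)] is nearly [phi(a_j, q)] for [j < i], and with every
[phi(a_i, q)] far from [dp q].  Then [phi(a_i, b_j)] and [phi(a_j, b_i)] stay
apart for [i < j], against the stability of [phi] in [M].

Both claims follow.  A limit of the numbers [phi(a, q)] is determined by them,
so [dp] identifies two types that give the same value to every [phi(a, y)]
([limit_determined]) and descends to a continuous function on the quotient;
exchanging the roles of [x] and [y] gives the same for [dq].  And [dq] is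
continuous with [dq a = phi(a, q)], so the limit of these numbers along
[a -> p] is also [dq p] ([limits_exchange]).

The construction takes place inside [M], hence needs that the types realised in
[M] are dense in the space of types over [M] ([realised_dense]).  Every
neighbourhood of a type contains a set [chi > 0] around it, for a single
formula [chi] with parameters in [M], and by elementarity such a set, when
nonempty, meets [M]: the variables of [chi] are eliminated by suprema one after
the other. *)

(** * Double limits *)

Section DoubleLimit.
Set Implicit Arguments.
Unset Strict Implicit.
Unset Printing Implicit Defensive.

(** Dependent choice in which each term is constrained by all earlier ones, as
they stand in the list [mkseq f n]. *)
Lemma sequence_by_history (T : Type) (ok : seq T -> T -> Prop) :
  (forall s, exists t, ok s t) ->
  exists f : nat -> T, forall n, ok (mkseq f n) (f n).
Proof.
move=> /choice[g gP].
pose hist n := iter n (fun s => rcons s (g s)) [::].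
exists (g \o hist) => n /=; suff -> : mkseq (g \o hist) n = hist n by [].
by elim: n => // n IH; rewrite mkseqS IH.
Qed.

Lemma near_dist (R : realType) (Z : topologicalType) (f : Z -> R) (z : Z)
    (e : R) :
  continuous f -> 0 < e -> \forall z' \near z, `|f z - f z'| < e.
Proof. by move=> fc e0; exact: (fc z _ (nbhsx_ballx (f z) e e0)). Qed.

(** [A] and [B] stand for the tuples of [M] in the variables [x] and [y], [P]
and [Q] for the two spaces of types over [M], [F] for [phi]; [FP b] and [FQ a]
are the extensions of [phi(_, b)] and [phi(a, _)] to these spaces. *)
Section Grothendieck.
Variables (R : realType) (A B : Type) (P Q : topologicalType).
Variables (alpha : A -> P) (beta : B -> Q) (F : A -> B -> R).
Variables (FP : B -> P -> R) (FQ : A -> Q -> R).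

Hypothesis alpha_dense : forall (p : P) (U : set P), nbhs p U ->
  exists a, U (alpha a).
Hypothesis beta_dense : forall (q : Q) (U : set Q), nbhs q U ->
  exists b, U (beta b).
Hypothesis FP_cont : forall b, continuous (FP b).
Hypothesis FQ_cont : forall a, continuous (FQ a).
Hypothesis FP_ext : forall a b, FP b (alpha a) = F a b.
Hypothesis FQ_ext : forall a b, FQ a (beta b) = F a b.
Hypothesis F_stable : forall e, 0 < e ->
  ~ exists (a : nat -> A) (b : nat -> B), forall i j, (i < j)%N ->
      e <= `|F (a i) (b j) - F (a j) (b i)|.

Variables (p : P) (dp : Q -> R).
Hypothesis dp_cont : continuous dp.
Hypothesis dp_ext : forall b, dp (beta b) = FP b p.

(** Otherwise points [a] far from the limit exist in every neighbourhood of [p],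
and alternating their choice with that of points [b] tending to [q] contradicts
[F_stable]. *)
Lemma double_limit (q : Q) (e : R) : 0 < e ->
  exists2 U, nbhs p U & forall a, U (alpha a) -> `|FQ a q - dp q| < e.
Proof.
move=> e0; apply: contrapT => far.
have far_near U : nbhs p U ->
    exists a, U (alpha a) /\ e <= `|FQ a q - dp q|.
  move=> pU; apply: contrapT => none; apply: far; exists U => // a Ua.
  by rewrite ltNge; apply/negP => ea; apply: none; exists a.
(* Three approximations are made in comparing [F (a i) (b j)] with
   [F (a j) (b i)], so errors below e/4 leave a gap of e/4. *)
have d0 : 0 < e / 4 by rewrite divr_gt0.
pose ok (s : seq (A * B)) (t : A * B) :=
  [/\ e <= `|FQ t.1 q - dp q|, `|dp q - dp (beta t.2)| < e / 4
    & forall i : 'I_(size s), let u := tnth (in_tuple s) i in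
      `|FP u.2 p - F t.1 u.2| < e / 4 /\ `|FQ u.1 q - F u.1 t.2| < e / 4].
have [s|f fP] := @sequence_by_history _ ok.
  have [a [aP a_far]] : exists a, (forall i : 'I_(size s),
      `|FP (tnth (in_tuple s) i).2 p - FP (tnth (in_tuple s) i).2 (alpha a)|
        < e / 4) /\ e <= `|FQ a q - dp q|.
    apply: (far_near [set p' | forall i : 'I_(size s),
      `|FP (tnth (in_tuple s) i).2 p - FP (tnth (in_tuple s) i).2 p'| < e / 4]).
    by apply: filter_forall => i; exact: near_dist.
  have [b [bq bP]] : exists b, `|dp q - dp (beta b)| < e / 4 /\
      forall i : 'I_(size s),
      `|FQ (tnth (in_tuple s) i).1 q - FQ (tnth (in_tuple s) i).1 (beta b)|
        < e / 4.
    apply: (@beta_dense q [set q' | `|dp q - dp q'| < e / 4 /\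
      forall i : 'I_(size s),
      `|FQ (tnth (in_tuple s) i).1 q - FQ (tnth (in_tuple s) i).1 q'| < e / 4]).
    apply: filterI; first exact: near_dist.
    by apply: filter_forall => i; exact: near_dist.
  exists (a, b); split => //= i.
  by rewrite -FP_ext -FQ_ext.
apply: (F_stable d0); exists (fst \o f), (snd \o f) => i j ij /=.
have [_ _] := fP j; have hi : (i < size (mkseq f j))%N by rewrite size_mkseq.
move=> /(_ (Ordinal hi)) /=; rewrite (tnth_nth (f 0%N)) /= nth_mkseq //.
move=> -[h1 h2].
have [h3 h4 _] := fP i; move: h3 h4 h1 h2; rewrite dp_ext.
set r1 := FQ _ q; set r2 := F _ _; set r3 := F _ _; set r4 := FP _ _.
set r5 := dp q.
rewrite !ltr_norml ler_normr => /orP h3 /andP[? ?] /andP[? ?] /andP[? ?].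
by rewrite ler_normr; apply/orP; case: h3 => h3; [left|right]; lra.
Qed.

(** [dp q] and [dp q'] are limits of the same numbers along the same proper
filter; the filter is proper because [alpha] has dense image. *)
Lemma limit_determined (q q' : Q) :
  (forall a, FQ a q = FQ a q') -> dp q = dp q'.
Proof.
move=> qq'; apply/eqP; rewrite -subr_eq0 -normr_le0; apply/ler_addgt0Pl => e e0.
have e20 : 0 < e / 2 by rewrite divr_gt0.
have [U pU UP] := double_limit q e20; have [V pV VP] := double_limit q' e20.
have [a [/UP h1 /VP]] := alpha_dense (filterI pU pV); rewrite -qq' => h2.
rewrite addr0; move: h1 h2; rewrite !ltr_norml ler_norml.
by move=> /andP[? ?] /andP[? ?]; apply/andP; split; lra.
Qed.

(** Both sides are the limit of [FQ a q] as [alpha a] tends to [p]: the left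
one by [double_limit], the right one by continuity of [dq]. *)
Lemma limits_exchange (q : Q) (dq : P -> R) :
  continuous dq -> (forall a, dq (alpha a) = FQ a q) -> dp q = dq p.
Proof.
move=> dqc dq_ext; apply/eqP; rewrite -subr_eq0 -normr_le0.
apply/ler_addgt0Pl => e e0; have e20 : 0 < e / 2 by rewrite divr_gt0.
have [U pU UP] := double_limit q e20.
have [a [/UP h1]] := alpha_dense (filterI pU (near_dist p dqc e20)).
rewrite /= dq_ext addr0; move: h1; rewrite !ltr_norml ler_norml.
by move=> /andP[? ?] /andP[? ?]; apply/andP; split; lra.
Qed.

End Grothendieck.
End DoubleLimit.

(** * Eliminating finitely many variables *)

Section Density.
Set Implicit Arguments.
Unset Strict Implicit.
Unset Printing Implicit Defensive.
Variables (R : realType) (L : signature R) (M : structure L).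

Lemma feval_Sup_gt0 (K : structure L) (V : sorts L -> Type) (s : sorts L)
    (f : formula (fext V s)) (rho : V ~> K) :
  0 < feval (Sup f) rho <-> exists m, 0 < feval f (fcons m rho).
Proof.
have vals_sup : has_sup (0 |` range (fun m => feval f (fcons m rho))).
  split; first by exists 0; left.
  by exists 1 => _ [->|[m _ <-]] //; have /andP[] := feval01 f (fcons m rho).
split=> [/(sup_gt vals_sup.1)[_ [->|[m _ <-]]] | [m m0]].
- by rewrite ltxx.
- by exists m.
apply: (lt_le_trans m0); apply: ub_le_sup; first exact: vals_sup.2.
by right; exists m.
Qed.

(** [isolate] presents the variables [V] as the remaining ones extended by a
new variable that replaces [v0], the form under which a quantifier binds it.
Whole pairs [existT V s v] are compared, because [v] and [v0] may have
different sorts. *)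
Section Isolate.
Variables (V W : sorts L -> Type) (s0 : sorts L) (v0 : V s0).

Definition others s := {v : V s | existT V s0 v0 <> existT V s v}.

Definition isolate (w : {s & V s}) : fext (fsum others W) s0 (projT1 w) :=
  match pselect (existT V s0 v0 = w) with
  | left e => eq_rect (existT V s0 v0)
      (fun w => fext (fsum others W) s0 (projT1 w)) fnew w e
  | right ne =>
      (let: existT s v as w' := w
         return existT V s0 v0 <> w' -> fext (fsum others W) s0 (projT1 w') in
       fun ne' => flift s (inl (exist _ v ne'))) ne
  end.

Lemma fcons_isolate (Z : sorts L -> Type) (a : V ~> Z) (g : W ~> Z) w :
  fcons (a s0 v0) (fjoin (fun s (v : others s) => a s (sval v)) g) (isolate w) =
  a (projT1 w) (projT2 w).
Proof.
rewrite /isolate; case: pselect => [e|]; first by case: w / e.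
by case: w.
Qed.

Definition isolate_ren : fsum V W ~> fext (fsum others W) s0 :=
  fjoin (Z := fext (fsum others W) s0)
    (fun s v => isolate (existT V s v)) (fun s w => flift s (inr w)).

End Isolate.

(** Without variables, a formula over [M] is a sentence with parameters in [M],
to which elementarity applies directly. *)
Lemma empty_context_in_base (N : elem_ext M) (V : sorts L -> Type)
    (a : V ~> N) : (forall s, V s -> False) ->
  exists a0 : V ~> M, forall psi : formula (fsum V (fun s => M s)),
    feval psi (fjoin a (@ext_emb _ _ _ N)) =
    feval psi (fjoin a0 (fun _ m => m)).
Proof.
move=> noV; exists (fun s v => False_rect _ (noV s v)) => psi.
pose closed := rename (fjoin (fun s v => False_rect (M s) (noV s v))
                             (fun _ m => m)) psi.
have := ext_elem N closed; rewrite !feval_rename => closedE.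
transitivity (feval psi (fun s v => @ext_emb _ _ _ N s
    (fjoin (fun s v => False_rect (M s) (noV s v)) (fun _ m => m) v))).
  by congr feval; apply: famext => s [v|m] //; case: (noV s v).
by rewrite closedE; congr feval; apply: famext => s [v|m].
Qed.

(** The Tarski-Vaught property for open conditions in finitely many variables.
Finiteness is expressed by an injective rank below [n], which survives the
removal of the variable of highest rank.  A positive value is used because the
supremum of a family is positive exactly when a member is, so quantifying a
variable out and choosing a value for it afterwards loses nothing. *)
Lemma witness_in_base (N : elem_ext M) n (V : sorts L -> Type)
    (rank : {s & V s} -> nat) (psi : formula (fsum V (fun s => M s)))
    (a : V ~> N) :
  (forall w, rank w < n)%N -> injective rank ->
  0 < feval psi (fjoin a (@ext_emb _ _ _ N)) ->
  exists a' : V ~> M, 0 < feval psi (fjoin a' (fun _ m => m)).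
Proof.
elim: n V rank psi a => [|n IH] V rank psi a rank_lt rank_inj psi_gt0.
  have noV s (v : V s) : False by have := rank_lt (existT V s v).
  have [a0 a0E] := empty_context_in_base a noV; exists a0.
  by rewrite -a0E.
(* Ranks need not fill the interval below [n + 1]. *)
have [[[s0 v0] rv0]|nov0] := pselect (exists w, rank w = n); last first.
  apply: (IH V rank psi a _ rank_inj psi_gt0) => w.
  rewrite ltn_neqAle -ltnS rank_lt andbT; apply/eqP => rw.
  by apply: nov0; exists w.
pose V' := others v0.
pose rank' (w : {s & V' s}) := rank (existT V _ (sval (projT2 w))).
pose psi' : formula (fsum V' (fun s => M s)) :=
  Sup (rename (isolate_ren (W := fun s => M s) v0) psi).
have rank'_lt w : (rank' w < n)%N.
  rewrite ltn_neqAle -ltnS rank_lt andbT; case: w => s [v ne]; apply/eqP => rw.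
  by case: (ne); apply: rank_inj; rewrite rv0 -rw.
have rank'_inj : injective rank'.
  pose restr w : existT V s0 v0 <> w -> {s & V' s} :=
    let: existT s v := w in fun ne => existT V' s (exist _ v ne).
  have restr_eq w w' (ne : _ <> w) (ne' : _ <> w') :
      w = w' -> restr w ne = restr w' ne'.
    by move=> e; subst w'; congr restr.
  by move=> [s [v ne]] [t [u ne']] /rank_inj /(restr_eq _ _ ne ne').
pose a0 s (v : V' s) := a s (sval v).
have psi'E (K : elem_ext M) (b : V' ~> K) (m : K s0) :
  feval (rename (isolate_ren (W := fun s => M s) v0) psi)
    (fcons m (fjoin b (@ext_emb _ _ _ K))) =
  feval psi (fjoin (fun s v => fcons m (fjoin b (@ext_emb _ _ _ K))
      (isolate (fun s => M s) v0 (existT V s v))) (@ext_emb _ _ _ K)).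
  by rewrite feval_rename; congr feval; apply: famext => s [].
have psi'_gt0 : 0 < feval psi' (fjoin a0 (@ext_emb _ _ _ N)).
  apply/feval_Sup_gt0.
  exists (a s0 v0); rewrite (psi'E N).
  suff -> : (fun s v => fcons (a s0 v0) (fjoin a0 (@ext_emb _ _ _ N))
      (isolate (fun s => M s) v0 (existT V s v))) = a by [].
  apply: (@famext _ V (fun s => N s)) => s v.
  exact: (fcons_isolate v0 (Z := fun s => N s) a (@ext_emb _ _ _ N)
    (existT V s v)).
have [b] := IH V' rank' psi' a0 rank'_lt rank'_inj psi'_gt0.
move=> /feval_Sup_gt0[m]; rewrite (psi'E (self_ext M)); eexists; eassumption.
Qed.

(** * Density of the types realised in the base structure *)

Definition place_rank (x : seq (sorts L)) (w : {s & place x s}) : nat :=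
  let: existT _ (Place i) := w in i.

Lemma place_rank_lt x (w : {s & place x s}) : (place_rank w < size x)%N.
Proof. by case: w => _ [i]; exact: ltn_ord. Qed.

Lemma place_rank_inj x : injective (@place_rank x).
Proof. by move=> [_ [i]] [_ [j]] /= /val_inj ->. Qed.

Lemma types_tp x (p : types M x) :
  exists (N : elem_ext M) (a : place x ~> N), p = tp a.
Proof.
case: p => p pP; have [N [a pE]] := pP; exists N, a; exact: eq_exist.
Qed.

Lemma type_val01 x (psi : pformula M x) (p : types M x) :
  0 <= type_val psi p <= 1.
Proof. by have [N [a ->]] := types_tp p; rewrite type_valE feval01. Qed.

Lemma type_val_cont x (psi : pformula M x) :
  continuous (type_val psi : types M x -> R).
Proof.
move=> p; have /cvg_sup/(_ psi) h : nbhs p --> p by [].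
exact: cvg_trans (cvg_app _ h) (@initial_continuous _ _ (type_val psi) p).
Qed.

Lemma type_val_Neg x (chi : pformula M x) (p : types M x) :
  type_val (Neg chi) p = 1 - type_val chi p.
Proof. by have [N [a ->]] := types_tp p; rewrite !type_valE. Qed.

Lemma type_val_Monus x (chi chi' : pformula M x) (p : types M x) :
  type_val (Monus chi chi') p = Num.max (type_val chi p - type_val chi' p) 0.
Proof. by have [N [a ->]] := types_tp p; rewrite !type_valE. Qed.

Lemma type_val_dyadic x (chi : pformula M x) n k (p : types M x) :
  (k <= 2 ^ n)%N -> type_val (dyadic chi n k) p = k%:R / (2 ^ n)%:R.
Proof.
by move=> ?; have [N [a ->]] := types_tp p; rewrite type_valE feval_dyadic.
Qed.

(** Sets [chi > 0] are closed under finite intersection, because [chi] monus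
([chi] monus [chi']) is the minimum, so these sets generate a filter around
[p]; it converges to [p] because a bound on [psi] by a dyadic number is itself
of the form [chi > 0].  The tuple is taken nonempty since otherwise there may be
no formula at all, hence no [chi] for the whole space. *)
Lemma nbhs_type_pos x (p : types M x) (U : set (types M x)) :
  (0 < size x)%N ->
  nbhs p U -> exists2 chi : pformula M x, 0 < type_val chi p &
    forall p', 0 < type_val chi p' -> U p'.
Proof.
move=> x0.
pose pos : set_system (types M x) := [set U |
  exists2 chi : pformula M x, 0 < type_val chi p &
    forall p', 0 < type_val chi p' -> U p'].
have trueP (chi : pformula M x) (p' : types M x) :
    0 < type_val (Neg (Monus chi chi)) p'.
  by rewrite type_val_Neg type_val_Monus subrr maxxx subr0.
have pos_filter : Filter pos.
  split=> [|A B [chi1 c1 h1] [chi2 c2 h2]|A B AB [chi c h]].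
  - pose v := @Var _ _ (fsum (place x) (fun s => M s)) _
      (inl (Place (Ordinal x0))).
    by exists (Neg (Monus (Dist v v) (Dist v v))).
  - have minP (p' : types M x) :
        (0 < type_val (Monus chi1 (Monus chi1 chi2)) p') =
        (0 < type_val chi1 p') && (0 < type_val chi2 p').
      rewrite !type_val_Monus !lt_max ltxx orbF subr_gt0 gt_max gtrBl.
      by rewrite andbC.
    exists (Monus chi1 (Monus chi1 chi2)); first by rewrite minP c1.
    by move=> p'; rewrite minP => /andP[/h1 ? /h2 ?].
  - by exists chi => // p' /h /AB.
(* The nontrivial inclusion is tested on one formula [psi] at a time, where the
   neighbourhood is an open interval of radius [e] around [r]. *)
suff : pos --> p by apply.
apply/cvg_sup => psi A [_ [[B oB <-] /= Bp BA]].
have /nbhs_ballP[e /= e0 eB] : nbhs (type_val psi p) B by exact: open_nbhs_nbhs.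
apply: (@filterS _ pos _ (fun p' => `|type_val psi p - type_val psi p'| < e)).
  by move=> p' /eB /BA.
have /andP[r0 r1] := type_val01 psi p; set r := type_val psi p in r0 r1 *.
apply: (@filterS _ pos _ (fun p' => type_val psi p' < r + e /\
                                     r - e < type_val psi p')).
  by move=> p' /= [? ?]; rewrite ltr_norml; apply/andP; split; lra.
apply: filterI.
- have [re|re] := ltP 1 (r + e).
    exists (Neg (Monus psi psi)) => // p' _.
    by have /andP[_ ?] := type_val01 psi p'; lra.
  (* [dyadic_between] gives a non-strict lower bound, hence e/2. *)
  have [n [k [kn l1 l2]]] : exists n k : nat, [/\ (k <= 2 ^ n)%N,
      r + e / 2 <= k%:R / (2 ^ n)%:R & k%:R / (2 ^ n)%:R < r + e :> R].
    by apply: dyadic_between => //; lra.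
  exists (Monus (dyadic psi n k) psi).
    rewrite type_val_Monus type_val_dyadic // lt_max ltxx orbF subr_gt0 -/r.
    by lra.
  move=> p'; rewrite type_val_Monus type_val_dyadic // lt_max ltxx orbF.
  rewrite subr_gt0 => h.
  exact: lt_trans h l2.
- have [re|re] := ltP (r - e) 0.
    exists (Neg (Monus psi psi)) => // p' _.
    by have /andP[? _] := type_val01 psi p'; lra.
  have [n [k [kn l1 l2]]] : exists n k : nat, [/\ (k <= 2 ^ n)%N,
      r - e <= k%:R / (2 ^ n)%:R & k%:R / (2 ^ n)%:R < r :> R].
    by apply: dyadic_between => //; lra.
  exists (Monus psi (dyadic psi n k)).
    by rewrite type_val_Monus type_val_dyadic // lt_max ltxx orbF subr_gt0.
  move=> p'; rewrite type_val_Monus type_val_dyadic // lt_max ltxx orbF.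
  rewrite subr_gt0 => h.
  exact: le_lt_trans l1 h.
Qed.

Lemma realised_dense x (p : types M x) (U : set (types M x)) :
  nbhs p U -> exists a : place x ~> M, U (tpM a).
Proof.
have [N [a pE]] := types_tp p; have [/size0nil x0|x0] := posnP (size x).
  (* The empty tuple of [M] realises [p], by elementarity alone. *)
  subst x => pU.
  have nov (s : sorts L) : place [::] s -> False by case=> -[].
  have [a0 a0E] := empty_context_in_base a nov; exists a0.
  suff -> : tpM a0 = p by exact: nbhs_singleton.
  rewrite pE; apply: eq_exist; apply/predeqP => psi.
  by rewrite /conditions_of /= a0E.
move=> /(nbhs_type_pos x0)[chi]; rewrite pE type_valE => chi_gt0 chiU.
have [a' a'P] := witness_in_base (@place_rank_lt x) (@place_rank_inj x) chi_gt0.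
by exists a'; apply: chiU; rewrite type_valE.
Qed.

End Density.

(** * Definitions of types of a stable formula *)

Lemma inst_at_tpM (R : realType) (L : signature R) (M : structure L)
    (x y : seq (sorts L)) (phi : formula (fsum (place x) (place y)))
    (a : place x ~> M) (b : place y ~> M) :
  type_val (inst_at phi b) (tpM a) = feval phi (fjoin a b).
Proof.
rewrite type_valE feval_rename; congr feval.
by apply: famext => s [].
Qed.

Lemma transpose_inst_at_tpM (R : realType) (L : signature R) (M : structure L)
    (x y : seq (sorts L)) (phi : formula (fsum (place x) (place y)))
    (a : place x ~> M) (b : place y ~> M) :
  type_val (inst_at (transpose phi) a) (tpM b) = feval phi (fjoin a b).
Proof.
rewrite inst_at_tpM feval_rename; congr feval.
by apply: famext => s [].
Qed.

(** The universal property of the quotient: since [d] is constant on classes,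
the arbitrary choice of representatives made by [repr] disappears in [d']. *)
Lemma factors_continuous (R : realType) (L : signature R) (M : structure L)
    (x y : seq (sorts L)) (phi : formula (fsum (place x) (place y)))
    (d : types M x -> R) :
  definable_predicate d ->
  (forall p p', (forall b : place y ~> M,
     type_val (inst_at phi b) p = type_val (inst_at phi b) p') -> d p = d p') ->
  let d' := d \o (repr : phi_types M phi -> types M x) in
  phi_predicate d' /\ d = as_definable d'.
Proof.
move=> [d_cont d01] d_inv d'; split.
  split=> [|p]; last exact: d01.
  apply: repr_comp_continuous => // p p' /eqP/eqquotP/asboolP pp'.
  by apply/eqP; exact: d_inv.
apply/funext => p; apply: d_inv => b.
by rewrite -(phi_valE phi b p).
Qed.

Theorem proposition7p16 (R : realType) (L : signature R) (T : theory L)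
  (x y : seq (sorts L)) (phi : formula (fsum (place x) (place y)))
  (phi_stable : stable T phi)
  (M : structure L) (MT : model T M)
  (p : phi_types M phi) (q : phi_types M (transpose phi))
  (dp : types M y -> R) (dq : types M x -> R)
  (dpE : is_definition p dp) (dqE : is_definition q dq) :
  exists (dp' : phi_types M (transpose phi) -> R) (dq' : phi_types M phi -> R),
    [/\ phi_predicate dp', dp = as_definable dp',
        phi_predicate dq', dq = as_definable dq'
      & dp' q = dq' p].
Proof.
have [[dp_cont _] dp_ext] := dpE; have [[dq_cont _] dq_ext] := dqE.
pose F (a : place x ~> M) (b : place y ~> M) := feval phi (fjoin a b).
pose FP (b : place y ~> M) (r : types M x) := type_val (inst_at phi b) r.
pose FQ (a : place x ~> M) (r : types M y) :=
  type_val (inst_at (transpose phi) a) r.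
have stF e : 0 < e ->
  ~ exists (a : nat -> place x ~> M) (b : nat -> place y ~> M),
    forall i j, (i < j)%N -> e <= `|F (a i) (b j) - F (a j) (b i)|.
  by move=> e0 unst; apply: (phi_stable e e0); exists M.
have stF' e : 0 < e ->
  ~ exists (b : nat -> place y ~> M) (a : nat -> place x ~> M),
    forall i j, (i < j)%N -> e <= `|F (a j) (b i) - F (a i) (b j)|.
  move=> e0 [b [a unst]]; apply: (stF e e0); exists a, b => i j ij.
  by rewrite distrC; exact: unst.
have FPc b : continuous (FP b) by exact: type_val_cont.
have FQc a : continuous (FQ a) by exact: type_val_cont.
have FPe a b : FP b (tpM a) = F a b by exact: inst_at_tpM.
have FQe a b : FQ a (tpM b) = F a b by exact: transpose_inst_at_tpM.
have [dpP dpF] : _ /\ _ :=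
  @factors_continuous _ _ _ _ _ (transpose phi) dp dpE.1
  (limit_determined (@realised_dense _ _ _ _) (@realised_dense _ _ _ _)
     FPc FQc FPe FQe stF dp_cont (fun b => esym (dp_ext b))).
have [dqP dqF] : _ /\ _ := @factors_continuous _ _ _ _ _ phi dq dqE.1
  (limit_determined (F := fun b a => F a b)
     (@realised_dense _ _ _ _) (@realised_dense _ _ _ _)
     FQc FPc (fun b a => FQe a b) (fun b a => FPe a b) stF' dq_cont
     (fun a => esym (dq_ext a))).
exists (dp \o repr), (dq \o repr); split => //=.
exact: (limits_exchange (@realised_dense _ _ _ _) (@realised_dense _ _ _ _)
  FPc FQc FPe FQe stF dp_cont (fun b => esym (dp_ext b)) dq_cont
  (fun a => esym (dq_ext a))).
Qed.
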